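(* Let $G=(V,E)$ with weight $\mu$ be an infinite, connected, locally finite weighted graph satisfying condition $(p_0)$, let $m>1$, and fix $o\in V$. Let $(p,q)\in G_1=\{(p,q): p\ge 0,\ m-1-p<q<m\}$. Suppose there exist constants $C>0$ and $n_1$ such that $$W_o(n)\le C\, n^{\frac{mp+q}{p+q-m+1}}(\ln n)^{\frac{m-1}{p+q-m+1}}\quad\text{for all } n\ge n_1.$$ Then the inequality $\Delta_m u+u^p|\nabla u|^q\le 0$ on $V$ admits no nontrivial positive solution.
   Context: Setting: $G=(V,E)$ is an infinite, connected, locally finite graph with no loops and no multiple edges; $x\sim y$ means $x$ and $y$ are joined by an edge. A weight is a symmetric function $\mu:V\times V\to[0,\infty)$ with $\mu_{xy}=\mu_{yx}>0$ if and only if $x\sim y$; the vertex measure is $\mu(x)=\sum_{y\sim x}\mu_{xy}$. For $m>1$ and $u:V\to\mathbb R$, $\Delta_m u(x)=\frac{1}{\mu(x)}\sum_{y\sim x}\mu_{xy}|u(y)-u(x)|^{m-2}(u(y)-u(x))$ and $|\nabla u(x)|=\big(\sum_{y\sim x}\frac{\mu_{xy}}{2\mu(x)}(u(y)-u(x))^2\big)^{1/2}$. Condition $(p_0)$: there is a constant $p_0>1$ such that $\mu_{xy}/\mu(x)\ge 1/p_0$ for all $x\sim y$. $d(x,y)$ is the graph (shortest path) distance, $B(o,n)=\{x\in V: d(o,x)\le n\}$, and $W_o(n)=\sum_{x\in B(o,n),\,y\in V,\,d(o,x)<d(o,y)}\mu_{xy}$. A nontrivial positive solution of $\Delta_m u+u^p|\nabla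 u|^q\le 0$ is a non-constant function $u:V\to(0,\infty)$ such that $\Delta_m u(x)+u(x)^p|\nabla u(x)|^q\le 0$ for every $x\in V$, with the conventions $0^0=1$, $0^q=0$ for $q>0$, and, for $q<0$, $|\nabla u(x)|^q=+\infty$ when $|\nabla u(x)|=0$ (so the inequality fails at such $x$). *)

(* Defs.v *)
From HB Require Import structures.
From mathcomp Require Import all_boot all_order all_algebra.
From mathcomp Require Import boolp classical_sets functions cardinality fsbigop.
From mathcomp Require Import reals exp.
Set Implicit Arguments. Unset Strict Implicit. Unset Printing Implicit Defensive.
Import Order.TTheory GRing.Theory Num.Theory.
Local Open Scope classical_set_scope.
Local Open Scope ring_scope.

Section Graph.
Variables (V : choiceType) (adj : rel V).

Definition simple_graph : Prop :=
  (forall x y, adj x y = adj y x) /\ (forall x, ~~ adj x x).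

Definition nbhd (x : V) : set V := [set y | adj x y].

Definition locally_finite : Prop := forall x, finite_set (nbhd x).

Definition infinite_graph : Prop := infinite_set [set: V].

Definition walk (n : nat) (x y : V) : Prop :=
  exists s : seq V, [/\ size s = n, path adj x s & last x s = y].

Definition connected_graph : Prop := forall x y, exists n, walk n x y.

(* graph (shortest path) distance; 0 if not connected (never used then) *)
Definition dist (x y : V) : nat :=
  match pselect (exists n, `[< walk n x y >]) with
  | left H => ex_minn H
  | right _ => 0%N
  end.

Variable R : realType.
Variable mu : V -> V -> R.

Definition weight : Prop :=
  (forall x y, mu x y = mu y x) /\ (forall x y, 0 <= mu x y) /\
  (forall x y, 0 < mu x y <-> adj x y).

Definition muV (x : V) : R := \sum_(y \in nbhd x) mu x y.

Definition cond_p0 (p0 : R) : Prop :=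
  1 < p0 /\ forall x y, adj x y -> p0^-1 <= mu x y / muV x.

Definition phi_m (m t : R) : R := if t == 0 then 0 else (`|t| `^ (m - 2)) * t.

Definition mLaplacian (m : R) (u : V -> R) (x : V) : R :=
  (muV x)^-1 * \sum_(y \in nbhd x) mu x y * phi_m m (u y - u x).

Definition grad_norm (u : V -> R) (x : V) : R :=
  Num.sqrt (\sum_(y \in nbhd x) mu x y / (2 * muV x) * (u y - u x) ^+ 2).

(* Delta_m u(x) + u(x)^p |grad u(x)|^q <= 0, with the conventions
   0^0 = 1, 0^q = 0 for q > 0 (built into powR), and for q < 0 the
   inequality fails when |grad u(x)| = 0. *)
Definition supersol_at (m p q : R) (u : V -> R) (x : V) : Prop :=
  (q < 0 -> 0 < grad_norm u x) /\
  mLaplacian m u x + (u x `^ p) * (grad_norm u x `^ q) <= 0.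

Definition nontrivial_positive_solution (m p q : R) (u : V -> R) : Prop :=
  (forall x, 0 < u x) /\ (exists x y, u x != u y) /\
  (forall x, supersol_at m p q u x).

(* W_o(n) = sum over x in B(o,n), y with d(o,x) < d(o,y) of mu_xy
   (mu_xy = 0 unless y ~ x, so y ranges over neighbours of x). *)
Definition W (o : V) (n : nat) : R :=
  \sum_(x \in [set x | (dist o x <= n)%N])
     \sum_(y \in [set y | adj x y && (dist o x < dist o y)%N]) mu x y.

End Graph.

(* Main.v *)
Require Import Defs.
From HB Require Import structures.
From mathcomp Require Import all_boot all_order all_algebra.
From mathcomp Require Import finmap ring lra.
From mathcomp Require Import boolp classical_sets functions cardinality fsbigop.
From mathcomp Require Import reals sequences exp.
Set Implicit Arguments. Unset Strict Implicit. Unset Printing Implicit Defensive.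
Import Order.TTheory GRing.Theory Num.Theory.
Local Open Scope ring_scope.

(** For a positive supersolution [u], let [D x] be the largest decrease of [u]
along an edge at [x].  Then [D x <= u x] trivially, and the inequality at [x]
together with (p0) bounds increases by a multiple of [D x].  This yields a
Harnack inequality for neighbours and makes [D x] comparable to the gradient.

Fix a level [M] and test with [f(u) eta(d)^s], where [eta] is a radial cutoff
and [f(v) = 1 + t ln(M/v)] for [v < M], [f(v) = 0] otherwise.  Attributing each
edge to its endpoint with the larger value of [u] gives, with [X = u^p |grad u|^q]
and [Y = D^m / u],
  sum_(u < M) mu X eta^s + (t/p0) sum_(u < M) mu Y eta^s
    <~ sum_(u < M) e (D^(m-1) + delta^(m-1)) eta^(s-1) theta,
where [e x] is the weight of the edges leaving [x] outwards, [theta] is the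
decrement of [eta], and [delta] decays like [exp(-1/t)].  Only the weights
entering [W_o] appear, since [eta] is radial.  With
[a = (m-1)/(mp+q)], [b = pa] and [c = 1-a-b], one has [D^(m-1) = (X')^a Y^b] for
[X' = u^p D^q], so Young's inequality bounds the right-hand side by small
multiples of the left-hand sums plus [sum e (t^(-b) theta)^(1/c)].  For a
logarithmic cutoff between the radii [2^k] and [2^(2k)] and [t ~ 1/k], the
critical growth of [W_o] keeps this last term bounded.  Absorbing first shows
[sum_(u < M) mu X < oo]; then, since the X-part of the right-hand side lives on
the annulus, a second use with a large weight on X and a small one on Y gives
[X = 0] wherever [u < M].  As [M] is arbitrary, [u] is constant. *)

(** * Graph distance and balls *)

Section Distance.
Variables (V : choiceType) (adj : rel V) (o : V).
Hypotheses (conn : connected_graph adj) (lf : locally_finite adj).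

Local Notation d := (dist adj o).

Lemma dist_walk (x : V) : walk adj (d x) o x.
Proof.
rewrite /dist; case: pselect => [H|nH]; first by case: ex_minnP => n /asboolP.
by case: nH; have [n wn] := conn o x; exists n; apply/asboolP.
Qed.

Lemma dist_le (n : nat) (x : V) : walk adj n o x -> (d x <= n)%N.
Proof.
move=> wn; rewrite /dist; case: pselect => [H|//].
by case: ex_minnP => k _; apply; apply/asboolP.
Qed.

Lemma dist_adj (x y : V) : adj x y -> (d y <= (d x).+1)%N.
Proof.
move=> xy; apply: dist_le; have [s [sz ps ls]] := dist_walk x.
exists (rcons s y); split; first by rewrite size_rcons sz.
- by rewrite rcons_path ps ls.
- by rewrite last_rcons.
Qed.

(** Dropping the last vertex of a shortest walk to [y] leaves a neighbour within distance [n]; by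
    [dist_adj] it cannot be closer. *)
Lemma dist_pred (n : nat) (y : V) : d y = n.+1 -> exists2 x, adj x y & d x = n.
Proof.
move=> dy; have [s [+ + ls]] := dist_walk y; rewrite dy.
case/lastP: s ls => [//|s z]; rewrite last_rcons size_rcons => -> [sz].
rewrite rcons_path => /andP[ps xy]; exists (last o s) => //.
apply/eqP; rewrite eqn_leq; apply/andP; split; first by apply: dist_le; exists s.
by rewrite -ltnS -dy dist_adj.
Qed.

Lemma finite_ball (n : nat) : finite_set [set x | (d x <= n)%N]%classic.
Proof.
elim: n => [|n IHn].
  apply: (@sub_finite_set _ _ [set o]%classic) => // x /=.
  rewrite leqn0 => /eqP dx; have := dist_walk x; rewrite dx.
  by case=> -[|z s] [// _ _ /= ->].
pose A := [set x | (d x <= n)%N]%classic.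
apply: (@sub_finite_set _ _ (A `|` \bigcup_(x in A) nbhd adj x)%classic).
  move=> y /=; rewrite leq_eqVlt => /orP[/eqP/dist_pred[x xy dx]|]; last by left.
  by right; exists x => //=; rewrite /A /= dx.
by rewrite finite_setU; split => //; apply: bigcup_finite.
Qed.

Definition ball (n : nat) : seq V := fset_set [set x | (d x <= n)%N]%classic.

Lemma mem_ball (n : nat) (x : V) : (x \in ball n) = (d x <= n)%N.
Proof.
rewrite /ball in_fset_set; last exact: finite_ball.
by apply/idP/idP; rewrite inE.
Qed.

Lemma ball_uniq (n : nat) : uniq (ball n).
Proof. exact: fset_uniq. Qed.

End Distance.

Lemma fsbig_seq_supp (T : choiceType) (R : realType) (A : set T) (s : seq T)
    (F : T -> R) :
  finite_set A -> uniq s -> (forall y, A y -> y \in s) ->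
  \sum_(y \in A) F y = \sum_(y <- s | `[< A y >]) F y.
Proof.
move=> finA us As; rewrite fsbig_finite// -[RHS]big_filter.
apply: perm_big; apply: uniq_perm; rewrite ?fset_uniq ?filter_uniq//.
move=> y; rewrite in_fset_set// mem_filter; apply/idP/andP.
  by move=> /set_mem Ay; split; [exact/asboolP|exact: As].
by case=> /asboolP Ay _; exact/mem_set.
Qed.

(** * Local estimates at a vertex *)

Section Phi.
Variables (R : realType) (m : R).
Hypothesis m_gt1 : 1 < m.

Lemma phi_mN (t : R) : phi_m m (- t) = - phi_m m t.
Proof. by rewrite /phi_m oppr_eq0 normrN; case: eqP; rewrite ?oppr0 ?mulrN. Qed.

Lemma phi_m_ge0 (t : R) : 0 <= t -> phi_m m t = t `^ (m - 1).
Proof.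
have m1 : 0 < m - 1 by rewrite subr_gt0.
move=> t0; rewrite /phi_m; case: eqP => [->|_]; first by rewrite powR0 ?gt_eqF.
rewrite ger0_norm// mulrC -[RHS]mulr_powRB1//.
by congr (_ * _ `^ _); lra.
Qed.

Lemma phi_m_le (t D : R) : 0 <= D -> t <= D -> phi_m m t <= D `^ (m - 1).
Proof.
move=> D0 tD; have [t0|t0] := leP 0 t.
  by rewrite phi_m_ge0// ge0_ler_powR// ?nnegrE// subr_ge0 ltW.
rewrite -[t]opprK phi_mN phi_m_ge0 ?oppr_ge0 ?(ltW t0)//.
by rewrite (@le_trans _ _ 0) ?oppr_le0 ?powR_ge0.
Qed.

End Phi.

(** * Descent, Harnack inequality and gradient comparison *)

Section Vertex.
Variables (V : choiceType) (adj : rel V) (R : realType) (mu : V -> V -> R).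
Variables (p0 m p q : R) (u : V -> R).
Hypotheses (lf : locally_finite adj) (wmu : weight adj mu).
Hypotheses (hp0 : cond_p0 adj mu p0) (m_gt1 : 1 < m).
Hypothesis (u_gt0 : forall x, 0 < u x).
Hypothesis (usol : forall x, supersol_at adj mu m p q u x).

Local Notation mV := (muV adj mu).
Local Notation grad := (grad_norm adj mu u).

Definition nb (x : V) : seq V := fset_set (nbhd adj x).

Lemma mem_nb (x y : V) : (y \in nb x) = adj x y.
Proof.
rewrite /nb in_fset_set; last exact: lf.
by apply/idP/idP; rewrite inE.
Qed.

Lemma nb_uniq (x : V) : uniq (nb x). Proof. exact: fset_uniq. Qed.

Lemma sum_nbhd (x : V) (F : V -> R) :
  \sum_(y \in nbhd adj x) F y = \sum_(y <- nb x) F y.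
Proof. by rewrite fsbig_finite. Qed.

Lemma muVE (x : V) : mV x = \sum_(y <- nb x) mu x y.
Proof. exact: sum_nbhd. Qed.

Lemma muV_ge0 (x : V) : 0 <= mV x.
Proof. by rewrite muVE sumr_ge0// => y _; case: wmu => _ []. Qed.

Lemma muV_gt0 (x y : V) : adj x y -> 0 < mV x.
Proof.
move=> xy; rewrite lt_neqAle muV_ge0 andbT eq_sym; apply/eqP => m0.
have [h /(_ _ _ xy)] := hp0; rewrite m0 invr0 mulr0 invr_le0 => p00.
by have := lt_le_trans h p00; rewrite ltr10.
Qed.

Lemma p0_gt0 : 0 < p0.
Proof. by case: hp0 => h _; apply: lt_trans h. Qed.

Lemma muV_le (x y : V) : adj x y -> mV x <= p0 * mu x y.
Proof.
move=> xy; have [_ /(_ _ _ xy)] := hp0.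
have m0 := muV_gt0 xy; rewrite ler_pdivlMr// ler_pdivrMl ?p0_gt0//.
Qed.

(** The [D] of the overview; the base value 0 is taken where no neighbour is lower. *)
Definition descent (x : V) : R := \big[Num.max/0]_(y <- nb x) (u x - u y).

Lemma descent_ge0 (x : V) : 0 <= descent x.
Proof. by rewrite /descent; elim/big_rec: _ => // y D _ D0; rewrite le_max D0 orbT. Qed.

Lemma le_descent (x y : V) : adj x y -> u x - u y <= descent x.
Proof.
rewrite -mem_nb => xy.
exact: (@le_bigmax_seq _ _ _ _ 0 y xpredT (fun z => u x - u z) xy).
Qed.

Lemma descent_attained (x : V) :
  0 < descent x -> exists2 y, adj x y & u x - u y = descent x.
Proof.
suff [->|//] : descent x = 0 \/ exists2 y, adj x y & u x - u y = descent x.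
  by rewrite ltxx.
rewrite /descent; have : {in nb x, forall y, adj x y} by move=> y; rewrite mem_nb.
elim: (nb x) => [|z s IHs] nbs; first by left; rewrite big_nil.
rewrite big_cons; case: leP => _; last first.
  by right; exists z => //; apply: nbs; rewrite mem_head.
by apply: IHs => y ys; apply: nbs; rewrite inE ys orbT.
Qed.

Lemma descent_le (x : V) : descent x <= u x.
Proof.
have := descent_ge0 x; rewrite le_eqVlt => /orP[/eqP <-|]; first exact: ltW.
by case/descent_attained => y _ <-; rewrite gerBl ltW.
Qed.

Lemma lap_le (x : V) :
  mV x * (u x `^ p * grad x `^ q) <= \sum_(y <- nb x) mu x y * phi_m m (u x - u y).
Proof.
have [_] := usol x; rewrite /mLaplacian sum_nbhd => h.
have := muV_ge0 x; rewrite le_eqVlt => /orP[/eqP m0|m0].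
  (* A vertex of zero measure has no neighbours, so both sides vanish. *)
  rewrite -m0 mul0r big_seq_cond big1// => y /andP[+ _].
  by rewrite mem_nb => /muV_gt0; rewrite -m0 ltxx.
rewrite -(ler_pM2l m0) mulr0 mulrDr mulrA mulfV ?gt_eqF// mul1r in h.
move: h; rewrite addrC -lerBrDr sub0r => /le_trans; apply.
rewrite -sumrN; apply: ler_sum => y _.
by rewrite -mulrN -phi_mN opprB.
Qed.

Definition harn : R := p0 `^ (m - 1)^-1.

Lemma harn_ge0 : 0 <= harn. Proof. exact: powR_ge0. Qed.

(** By [lap_le] the total flux at [x] is nonnegative, so the upward flux through [xy] is balanced by
    downward ones. Their total weight is at most [p0 * mu x y]; taking the root of order [m - 1]
    gives [harn]. *)
Lemma rise_le (x y : V) : adj x y -> u y - u x <= harn * descent x.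
Proof.
move=> xy; have [D0 h0] := (descent_ge0 x, harn_ge0).
have m1 : 0 < m - 1 by rewrite subr_gt0.
have [yx|xy'] := leP (u y) (u x).
  by rewrite (@le_trans _ _ 0) ?subr_le0// mulr_ge0.
have mxy : 0 < mu x y by case: wmu => _ [_ ->].
have mu0 z : 0 <= mu x z by case: wmu => _ [].
have lap0 : 0 <= \sum_(z <- nb x) mu x z * phi_m m (u x - u z).
  by apply: le_trans (lap_le x); rewrite !mulr_ge0 ?powR_ge0 ?muV_ge0.
have key : mu x y * (u y - u x) `^ (m - 1) <= mV x * descent x `^ (m - 1).
  move: lap0; rewrite (bigD1_seq y) ?nb_uniq ?mem_nb//= -opprB phi_mN.
  rewrite phi_m_ge0 ?subr_ge0 ?(ltW xy')// mulrN addrC subr_ge0 => /le_trans; apply.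
  apply: (@le_trans _ _ (\sum_(z <- nb x | z != y) mu x z * descent x `^ (m - 1))).
    rewrite big_seq_cond [leRHS]big_seq_cond; apply: ler_sum => z.
    rewrite mem_nb => /andP[xz _].
    by rewrite ler_wpM2l// phi_m_le// le_descent.
  rewrite muVE mulr_suml [leRHS](bigD1_seq y) ?nb_uniq ?mem_nb//= lerDr.
  by rewrite mulr_ge0 ?powR_ge0.
have {}key : (u y - u x) `^ (m - 1) <= p0 * descent x `^ (m - 1).
  rewrite -(ler_pM2l mxy) (le_trans key)// mulrA ler_wpM2r ?powR_ge0//.
  by rewrite mulrC muV_le.
have d0 : 0 <= u y - u x by rewrite subr_ge0 ltW.
rewrite -[leLHS]powRr1// -(mulfV (lt0r_neq0 m1)) powRrM.
apply: (@le_trans _ _ ((p0 * descent x `^ (m - 1)) `^ (m - 1)^-1)).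
  rewrite ge0_ler_powR ?nnegrE ?powR_ge0 ?invr_ge0 ?(ltW m1)//.
  by rewrite mulr_ge0 ?powR_ge0 ?(ltW p0_gt0).
by rewrite powRM ?powR_ge0 ?(ltW p0_gt0)// -powRrM mulfV ?gt_eqF// powRr1.
Qed.

Lemma harnack (x y : V) : adj x y -> u y <= (1 + harn) * u x.
Proof.
move=> xy; have := rise_le xy; have := descent_le x; have := harn_ge0.
by move=> h0 /(ler_wpM2l h0); lra.
Qed.

Lemma grad_norm_ge0 (x : V) : 0 <= grad x. Proof. exact: sqrtr_ge0. Qed.

Lemma grad_sqr (x : V) :
  grad x ^+ 2 = \sum_(y <- nb x) mu x y / (2 * mV x) * (u y - u x) ^+ 2.
Proof.
rewrite /grad_norm sum_nbhd sqr_sqrtr// sumr_ge0// => y _.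
by rewrite mulr_ge0 ?sqr_ge0// divr_ge0 ?mulr_ge0 ?muV_ge0//; case: wmu => _ [].
Qed.

(** The edge realising the descent has weight at least [mV x / p0] and alone gives this bound. *)
Lemma descent_le_grad (x : V) : descent x <= Num.sqrt (2 * p0) * grad x.
Proof.
have := descent_ge0 x; rewrite le_eqVlt => /orP[/eqP <-|D0].
  by rewrite mulr_ge0 ?sqrtr_ge0 ?grad_norm_ge0.
have [y xy yD] := descent_attained D0.
have m0 := muV_gt0 xy.
have s0 : 0 <= Num.sqrt (2 * p0) * grad x by rewrite mulr_ge0 ?sqrtr_ge0 ?grad_norm_ge0.
rewrite -(@ler_pXn2r _ 2)// ?nnegrE ?descent_ge0//.
rewrite exprMn sqr_sqrtr; last by rewrite mulr_ge0 ?(ltW p0_gt0).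
rewrite grad_sqr (bigD1_seq y) ?nb_uniq ?mem_nb//= mulrDr.
apply: (@le_trans _ _ (2 * p0 * (mu x y / (2 * mV x) * (u y - u x) ^+ 2))).
  rewrite -(opprB (u x)) yD sqrrN mulrA -[leLHS]mul1r ler_wpM2r ?sqr_ge0//.
  rewrite mulrA ler_pdivlMr ?mulr_gt0// mul1r -mulrA ler_pM2l//.
  exact: muV_le.
rewrite lerDl mulr_ge0 ?mulr_ge0 ?(ltW p0_gt0)// sumr_ge0// => z _.
by rewrite mulr_ge0 ?sqr_ge0// divr_ge0 ?mulr_ge0 ?muV_ge0//; case: wmu => _ [].
Qed.

Lemma grad_le_descent (x : V) : grad x <= (1 + harn) * descent x.
Proof.
have [D0 h0] := (descent_ge0 x, harn_ge0).
have H0 : 0 <= (1 + harn) * descent x by rewrite mulr_ge0// addr_ge0.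
rewrite -(@ler_pXn2r _ 2)// ?nnegrE ?grad_norm_ge0// grad_sqr.
apply: (@le_trans _ _
  (\sum_(y <- nb x) mu x y / (2 * mV x) * ((1 + harn) * descent x) ^+ 2)).
  rewrite big_seq [leRHS]big_seq; apply: ler_sum => y; rewrite mem_nb => xy.
  apply: ler_wpM2l.
    by rewrite divr_ge0 ?mulr_ge0 ?muV_ge0//; case: wmu => _ [].
  rewrite -(real_normK (num_real (u y - u x))) (@ler_pXn2r _ 2)// ?nnegrE//.
  rewrite ler_norml; have := rise_le xy; have := le_descent xy.
  have : 0 <= harn * descent x by rewrite mulr_ge0.
  by move=> *; apply/andP; split; lra.
rewrite -mulr_suml -mulr_suml -muVE; set E := _ ^+ 2.
have E0 : 0 <= E by rewrite sqr_ge0.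
have := muV_ge0 x; rewrite le_eqVlt => /orP[/eqP <-|m0]; first by rewrite !mul0r.
rewrite -[leRHS]mul1r ler_wpM2r// ler_pdivrMr ?mulr_gt0// mul1r.
by rewrite ler_peMl ?ler1n// ltW.
Qed.

Lemma descent0_const (x y : V) : adj x y -> descent x = 0 -> u y = u x.
Proof.
move=> xy D0; have := le_descent xy; have := rise_le xy; rewrite D0 mulr0 !subr_le0.
by move=> ? ?; apply/eqP; rewrite eq_le; apply/andP.
Qed.

(** For [q >= 0] the gradient must be bounded below by the descent, for [q < 0] above, the power
    being decreasing; hence two values of [c0]. *)
Lemma source_ge : exists2 c0 : R, 0 < c0 & forall x, 0 < descent x ->
  c0 * (u x `^ p * descent x `^ q) <= u x `^ p * grad x `^ q.
Proof.
have H0 : 0 < 1 + harn by rewrite ltr_pwDl// harn_ge0.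
have s0 : 0 < Num.sqrt (2 * p0) by rewrite sqrtr_gt0 mulr_gt0// p0_gt0.
have [q0|q0] := leP 0 q.
  exists ((Num.sqrt (2 * p0) `^ q)^-1); first by rewrite invr_gt0 powR_gt0.
  move=> x D0; rewrite ler_pdivrMl ?powR_gt0// mulrCA ler_wpM2l ?powR_ge0//.
  rewrite -powRM ?(ltW s0) ?grad_norm_ge0//.
  rewrite ge0_ler_powR ?nnegrE ?descent_ge0 ?descent_le_grad//.
  by rewrite mulr_ge0 ?grad_norm_ge0 ?(ltW s0).
exists ((1 + harn) `^ q); first by rewrite powR_gt0.
move=> x D0; rewrite mulrCA ler_wpM2l ?powR_ge0// -powRM ?(ltW H0) ?descent_ge0//.
have g0 : 0 < grad x.
  have := lt_le_trans D0 (descent_le_grad x).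
  by rewrite pmulr_rgt0.
rewrite -[q]opprK !(powRN _ (- q)) lef_pV2 ?posrE ?powR_gt0 ?mulr_gt0//.
rewrite ge0_ler_powR ?nnegrE ?grad_le_descent// ?oppr_ge0 ?(ltW q0) ?(ltW g0)//.
by rewrite mulr_ge0 ?(ltW H0) ?descent_ge0.
Qed.

Lemma energy_ge (x : V) : p0^-1 * mV x * descent x `^ m <=
  \sum_(y <- nb x | u y < u x) mu x y * (u x - u y) `^ m.
Proof.
have mu0 z : 0 <= mu x z by case: wmu => _ [].
have := descent_ge0 x; rewrite le_eqVlt => /orP[/eqP <-|D0].
  rewrite powR0 ?mulr0 ?sumr_ge0// ?gt_eqF ?(lt_trans _ m_gt1)// => y _.
  by rewrite mulr_ge0 ?powR_ge0.
have [y xy yD] := descent_attained D0.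
have yx : u y < u x by rewrite -subr_gt0 yD.
rewrite big_mkcond /= (bigD1_seq y) ?nb_uniq ?mem_nb//= yx yD.
rewrite -[leLHS]addr0 lerD ?sumr_ge0//; last first.
  by move=> z _; case: ifP => // _; rewrite mulr_ge0 ?powR_ge0.
by rewrite ler_wpM2r ?powR_ge0// ler_pdivrMl ?p0_gt0// muV_le.
Qed.
End Vertex.

(** * The radial energy estimate *)

Lemma ln_le_powR (R : realType) (z r : R) : 0 < z -> 0 < r -> ln z <= z `^ r / r.
Proof.
move=> z0 r0; rewrite ler_pdivlMr// /powR gt_eqF// mulrC.
by apply: le_trans (expR_ge1Dx _); rewrite lerDr.
Qed.

Lemma subrXX_le (R : realDomainType) (a b : R) (n : nat) : 0 <= b -> b <= a ->
  a ^+ n.+1 - b ^+ n.+1 <= n.+1%:R * a ^+ n * (a - b).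
Proof.
move=> b0 ba; have a0 := le_trans b0 ba.
rewrite subrXX mulrC ler_wpM2r ?subr_ge0//.
rewrite mulr_natl -[X in _ *+ X]card_ord -sumr_const; apply: ler_sum => i _.
rewrite /= -[X in _ <= a ^+ X](subnK (ltnSE (ltn_ord i))) exprD.
by rewrite ler_wpM2l ?exprn_ge0// lerXn2r ?nnegrE.
Qed.

(** Discrete Green formula. Pairs with equal [u] contribute nothing since [h 0 = 0]; every other
    pair is charged to its endpoint with the larger [u]. *)
Lemma sum_antisym (T : Type) (R : realType) (s : seq T) (w : T -> T -> R)
    (u psi : T -> R) (h : R -> R) :
  (forall x y, w x y = w y x) -> (forall t, h (- t) = - h t) ->
  \sum_(x <- s) psi x * (\sum_(y <- s) w x y * h (u x - u y)) =
  \sum_(x <- s) \sum_(y <- s | u y < u x) w x y * h (u x - u y) * (psi x - psi y).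
Proof.
move=> wC hN; pose G x y := psi x * (w x y * h (u x - u y)).
have h0 : h 0 = 0 by have := hN 0; rewrite oppr0; lra.
have -> : \sum_(x <- s) psi x * (\sum_(y <- s) w x y * h (u x - u y)) =
    \sum_(x <- s) \sum_(y <- s) (if u y < u x then G x y else 0) +
    \sum_(x <- s) \sum_(y <- s) (if u x < u y then G x y else 0).
  rewrite -big_split; apply: eq_bigr => x _.
  rewrite mulr_sumr -big_split; apply: eq_bigr => y _ /=.
  rewrite -/(G x y); case: (ltgtP (u x) (u y)) => [_|_|e]; rewrite ?addr0 ?add0r//.
  by rewrite /G e subrr h0 !mulr0.
rewrite [X in _ + X]exchange_big -big_split; apply: eq_bigr => x _ /=.
rewrite [RHS]big_mkcond -big_split; apply: eq_bigr => y _ /=.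
case: ifP => _; last by rewrite addr0.
by rewrite /G (wC y x) -(opprB (u x)) hN; ring.
Qed.

Section MainEstimate.
Variables (V : choiceType) (adj : rel V) (R : realType) (mu : V -> V -> R).
Variables (p0 m p q : R) (u : V -> R) (o : V).
Hypotheses (conn : connected_graph adj).
Hypotheses (lf : locally_finite adj) (wmu : weight adj mu).
Hypotheses (hp0 : cond_p0 adj mu p0) (m_gt1 : 1 < m).
Hypothesis (u_gt0 : forall x, 0 < u x).
Hypothesis (usol : forall x, supersol_at adj mu m p q u x).

Local Notation mV := (muV adj mu).
Local Notation grad := (grad_norm adj mu u).
Local Notation d := (dist adj o).
Local Notation descent := (descent adj u).
Local Notation H := (1 + harn p0 m).

Definition source (x : V) : R := u x `^ p * grad x `^ q.

Definition outflow (x : V) : R :=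
  \sum_(y \in [set y | adj x y && (d x < d y)%N]%classic) mu x y.

Lemma mu_ge0 (x y : V) : 0 <= mu x y. Proof. by case: wmu => _ []. Qed.

Lemma mu_eq0 (x y : V) : ~~ adj x y -> mu x y = 0.
Proof.
case: wmu => _ [mu0 muadj] nxy; apply/eqP; rewrite eq_le mu0 andbT leNgt.
by apply: contra nxy => /muadj.
Qed.

Lemma outflow_ball (N : nat) (x : V) : (d x < N)%N ->
  outflow x = \sum_(y <- ball adj o N | adj x y && (d x < d y)%N) mu x y.
Proof.
move=> xN; rewrite /outflow (@fsbig_seq_supp _ _ _ (ball adj o N)).
- by apply: eq_bigl => y; apply/asboolP/idP.
- by apply: (sub_finite_set _ (lf x)) => y /= /andP[].
- exact: ball_uniq.
- by move=> y /= /andP[/dist_adj xy _]; rewrite mem_ball// (leq_trans (xy o conn)).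
Qed.

(** Non-neighbours have weight zero, and the strict bound [d x < N] keeps all neighbours of [x] in
    the ball. *)
Lemma nb_ball (N : nat) (x : V) (P : pred V) (F : V -> R) : (d x < N)%N ->
  \sum_(y <- nb adj x | P y) mu x y * F y =
  \sum_(y <- ball adj o N | P y) mu x y * F y.
Proof.
move=> xN; rewrite [RHS](bigID (adj x)) /= [X in _ = _ + X]big1 ?addr0; last first.
  by move=> y /andP[_ nxy]; rewrite mu_eq0// mul0r.
rewrite -[LHS]big_filter -[RHS]big_filter; apply: perm_big; apply: uniq_perm.
- by rewrite filter_uniq// nb_uniq.
- by rewrite filter_uniq// ball_uniq.
move=> y; rewrite !mem_filter mem_nb// mem_ball// -andbA; congr (_ && _).
apply/idP/andP => [xy|[]//]; split => //.
by rewrite (leq_trans (dist_adj o conn xy)).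
Qed.

Lemma outflow_ge0 (x : V) : 0 <= outflow x.
Proof.
rewrite (@outflow_ball (d x).+1)//; apply: sumr_ge0 => y _; exact: mu_ge0.
Qed.

Lemma outflow_le (x : V) : outflow x <= mV x.
Proof.
have dx : (d x < (d x).+1)%N by [].
rewrite (outflow_ball dx) muVE//.
under [leRHS]eq_bigr do rewrite -[mu _ _]mulr1.
rewrite (nb_ball xpredT _ dx) big_mkcond; apply: ler_sum => y _.
by rewrite mulr1; case: ifP => // _; exact: mu_ge0.
Qed.

Section Test.
Variables (M t : R) (N n : nat) (eta : nat -> R).
Hypotheses (M_gt0 : 0 < M) (t_gt0 : 0 < t) (t_le1 : t <= 1).
Hypothesis eta_ge0 : forall r, 0 <= eta r.
Hypothesis eta_noninc : forall r s, (r <= s)%N -> eta s <= eta r.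
Hypothesis eta_supp : forall r, (N <= r)%N -> eta r = 0.

Local Notation B := (ball adj o N).
Local Notation theta r := (eta r - eta r.+1).

(* [delta] is chosen so that [t * ln (M / v) <= 1] as soon as [H * v >= delta]. *)
Definition delta : R := M * H * expR (- t^-1).

Definition test (v : R) : R := if v < M then 1 + t * ln (M / v) else 0.

Lemma H_gt0 : 0 < H. Proof. by rewrite ltr_pwDl// harn_ge0. Qed.

Lemma delta_gt0 : 0 < delta.
Proof. by rewrite /delta !mulr_gt0 ?expR_gt0 ?H_gt0. Qed.

Lemma test_ge1 (v : R) : 0 < v -> v < M -> 1 <= test v.
Proof.
move=> v0 vM; rewrite /test vM lerDl mulr_ge0 ?(ltW t_gt0)// ln_ge0//.
by rewrite ler_pdivlMr// mul1r ltW.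
Qed.

Lemma test_ge0 (v : R) : 0 < v -> 0 <= test v.
Proof.
move=> v0; have [vM|vM] := ltP v M; first by apply: le_trans (test_ge1 v0 vM).
by rewrite /test ltNge vM.
Qed.

Lemma test_slope (v w : R) : 0 < w -> w < v -> v < M ->
  t * ((v - w) / v) <= test w - test v.
Proof.
move=> w0 wv vM; have v0 := lt_trans w0 wv; have wM := lt_trans wv vM.
rewrite /test vM wM opprD addrACA subrr add0r -mulrBr ler_pM2l//.
rewrite -ln_div ?posrE ?divr_gt0//.
have -> : M / w / (M / v) = (w / v)^-1 by field; rewrite !gt_eqF.
rewrite lnV ?posrE ?divr_gt0// lerNr -mulNr opprB mulrBl divff ?gt_eqF//.
have -> : w / v = 1 + (w / v - 1) by ring.
apply: le_trans (le_ln1Dx _) _; last by lra.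
by rewrite ltrBrDl subrr divr_gt0.
Qed.

(** Since [v <= H * w], [M / w] is at most [delta / v] times [exp (1 / t)], so
    [t * ln (M / w) <= 1 + t * ln (delta / v)]. The last logarithm is traded for a power of order
    [m - 1], which cancels against the flux in [test_descent_le]. *)
Lemma test_le (v w : R) : 0 < w -> w < M -> 0 < v -> v <= H * w ->
  test w <= 2 + (delta / v) `^ (m - 1) / (m - 1).
Proof.
move=> w0 wM v0 vw; have H0 := H_gt0; have d0 := delta_gt0.
have m1 : 0 < m - 1 by rewrite subr_gt0.
rewrite /test wM.
have h1 : ln (M / w) <= t^-1 + ln (delta / v).
  rewrite -lerBlDl -[t^-1]expRK -ln_div ?posrE ?expR_gt0 ?divr_gt0//.
  rewrite ler_ln ?posrE ?divr_gt0 ?expR_gt0// /delta expRN.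
  rewrite ler_pdivlMr//; have e0 := expR_gt0 t^-1.
  have -> : M / w / expR t^-1 * v = M / expR t^-1 * (v / w) by ring.
  rewrite [leRHS]mulrAC ler_pM2l ?divr_gt0// ler_pdivrMr//.
have {}h1 : t * ln (M / w) <= 1 + t * ln (delta / v).
  by rewrite -[X in X + _](mulfV (lt0r_neq0 t_gt0)) -mulrDr ler_pM2l.
have h2 : t * ln (delta / v) <= (delta / v) `^ (m - 1) / (m - 1).
  have P0 : 0 <= (delta / v) `^ (m - 1) / (m - 1).
    by rewrite divr_ge0 ?powR_ge0 ?ltW.
  have [l0|l0] := leP (ln (delta / v)) 0.
    by rewrite (le_trans _ P0)// mulr_ge0_le0 ?(ltW t_gt0).
  apply: le_trans (ln_le_powR (divr_gt0 d0 v0) m1).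
  by rewrite ler_piMl ?(ltW l0).
lra.
Qed.

Definition gap (x : V) : R := 2 * descent x `^ (m - 1) + delta `^ (m - 1) / (m - 1).

Let psi (x : V) : R := test (u x) * eta (d x) ^+ n.+1.

Lemma psi_ge0 (x : V) : 0 <= psi x.
Proof. by rewrite mulr_ge0 ?exprn_ge0// test_ge0. Qed.

(** In the product with [test_le] the difference is bounded by [descent x] in the first term and by
    [u x] in the second, where it cancels the denominator. *)
Lemma test_descent_le (x y : V) : adj x y -> u y < u x -> u x < M ->
  test (u y) * (u x - u y) `^ (m - 1) <= gap x.
Proof.
move=> xy yx xM; have yM := lt_trans yx xM.
have m1 : 0 < m - 1 by rewrite subr_gt0.
have d0 : 0 <= u x - u y by rewrite subr_ge0 ltW.
(* The Harnack inequality is needed from the lower vertex [y] up to [x], hence the reversed edge. *)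
have yx' : adj y x by case: wmu => muC [_ muadj]; apply/muadj; rewrite muC; apply/muadj.
have hH : u x <= H * u y by exact: (harnack lf wmu hp0 m_gt1 u_gt0 usol).
have h1 := test_le (u_gt0 y) yM (u_gt0 x) hH.
have P0 : 0 <= (delta / u x) `^ (m - 1) / (m - 1) by rewrite divr_ge0 ?powR_ge0 ?ltW.
apply: le_trans (ler_wpM2r (powR_ge0 _ _) h1) _.
rewrite mulrDl lerD//.
  by rewrite ler_wpM2l// ge0_ler_powR ?nnegrE ?descent_ge0 ?le_descent// ltW.
rewrite mulrAC ler_wpM2r ?invr_ge0 ?(ltW m1)//.
have du : 0 <= delta / u x by rewrite divr_ge0// ltW// delta_gt0.
have dl := ltW delta_gt0; rewrite -powRM//.
apply: ge0_ler_powR; rewrite ?nnegrE ?(ltW m1) ?(mulr_ge0 du d0)//.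
rewrite -mulrA ler_piMr// mulrC ler_pdivrMr// mul1r.
by rewrite lerBlDr lerDl ltW.
Qed.

Lemma gap_ge0 (x : V) : 0 <= gap x.
Proof.
have m1 : 0 < m - 1 by rewrite subr_gt0.
by rewrite addr_ge0 ?mulr_ge0 ?powR_ge0// invr_ge0 ltW.
Qed.

Lemma theta_ge0 (r : nat) : 0 <= theta r.
Proof. by rewrite subr_ge0 eta_noninc. Qed.

(** The increment of [psi] splits into a change of [test], giving the negative energy term by
    [test_slope], and a change of the cutoff, which can be positive only on outward edges. *)
Lemma edge_flux (x y : V) : u y < u x -> u x < M ->
  mu x y * phi_m m (u x - u y) * (psi x - psi y) <=
  mu x y * (u x - u y) `^ m * - (t / u x * eta (d x) ^+ n.+1) +
  (if adj x y && (d x < d y)%N then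
    mu x y * (n.+1%:R * (eta (d x) ^+ n * theta (d x)) * gap x) else 0).
Proof.
move=> yx xM; have yM := lt_trans yx xM; have m1 : 0 < m - 1 by rewrite subr_gt0.
have d0 : 0 <= u x - u y by rewrite subr_ge0 ltW.
case xy : (adj x y); last by rewrite mu_eq0 ?xy// !mul0r addr0.
rewrite phi_m_ge0//.
have -> : psi x - psi y = - ((test (u y) - test (u x)) * eta (d x) ^+ n.+1) +
    test (u y) * (eta (d x) ^+ n.+1 - eta (d y) ^+ n.+1) by rewrite /psi; ring.
rewrite mulrDr lerD//.
  rewrite !mulrN lerN2 -!mulrA ler_wpM2l ?mu_ge0//.
  rewrite -(@mulr_powRB1 _ (u x - u y) m) ?(lt_trans _ m_gt1)//.
  have -> : (u x - u y) * (u x - u y) `^ (m - 1) * (t * ((u x)^-1 * eta (d x) ^+ n.+1))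
    = (u x - u y) `^ (m - 1) * (t * ((u x - u y) / u x) * eta (d x) ^+ n.+1) by ring.
  rewrite ler_wpM2l ?powR_ge0// ler_wpM2r ?exprn_ge0//.
  exact: test_slope.
rewrite -mulrA [X in mu x y * X]mulrA [X in mu x y * (X * _)]mulrC.
(* An outward edge joins consecutive spheres, so the cutoff drops by one [theta]; otherwise it does
   not drop from [x] to [y]. *)
case: ltnP => xy' /=.
  rewrite ler_wpM2l ?mu_ge0// [leRHS]mulrC.
  have dy : d y = (d x).+1 by apply/eqP; rewrite eqn_leq xy' (dist_adj o conn xy).
  apply: ler_pM; rewrite ?mulr_ge0 ?powR_ge0 ?test_ge0 ?test_descent_le//.
    by rewrite subr_ge0 lerXn2r ?nnegrE ?eta_noninc// ltnW.
  by rewrite mulrA dy subrXX_le// eta_noninc.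
rewrite mulr_ge0_le0 ?mu_ge0// mulr_ge0_le0 ?mulr_ge0 ?powR_ge0 ?test_ge0//.
by rewrite subr_le0 lerXn2r ?nnegrE ?eta_noninc.
Qed.

Lemma vertex_flux (x : V) :
  \sum_(y <- B | u y < u x) mu x y * phi_m m (u x - u y) * (psi x - psi y) <=
  if u x < M then
    - (t / p0 * mV x * (descent x `^ m / u x) * eta (d x) ^+ n.+1) +
    n.+1%:R * outflow x * (eta (d x) ^+ n * theta (d x)) * gap x
  else 0.
Proof.
have le0 : psi x = 0 ->
    \sum_(y <- B | u y < u x) mu x y * phi_m m (u x - u y) * (psi x - psi y) <= 0.
  move=> ->; apply: sumr_le0 => y yx.
  rewrite sub0r mulrN oppr_le0 mulr_ge0 ?psi_ge0// mulr_ge0 ?mu_ge0//.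
  by rewrite phi_m_ge0 ?powR_ge0// subr_ge0 ltW.
(* Above the level [psi x = 0] and all flux terms are nonpositive, so the jump of [test] at [M] is
   harmless. *)
case: (boolP (u x < M)) => xM; last by apply: le0; rewrite /psi /test (negPf xM) mul0r.
have [Nx|xN] := leqP N (d x).
  have e0 := eta_supp Nx; have e1 := eta_supp (leqW Nx).
  rewrite e0 e1 subrr exprS !(mulr0, mul0r) oppr0 addr0; apply: le0.
  by rewrite /psi e0 exprS mul0r mulr0.
apply: (le_trans (@ler_sum _ _ B (fun y => u y < u x) _ _ (fun y yx => edge_flux yx xM))).
rewrite big_split /= lerD//.
  rewrite -mulr_suml mulrN lerN2.
  have -> : t / p0 * mV x * (descent x `^ m / u x) * eta (d x) ^+ n.+1 =
    p0^-1 * mV x * descent x `^ m * (t / u x * eta (d x) ^+ n.+1) by ring.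
  rewrite ler_wpM2r ?mulr_ge0 ?invr_ge0 ?exprn_ge0 ?(ltW t_gt0) ?(ltW (u_gt0 x))//.
  apply: le_trans (energy_ge u lf wmu hp0 m_gt1 x) _.
  by rewrite (nb_ball (fun y => u y < u x) (fun y => (u x - u y) `^ m) xN).
have G0 : 0 <= n.+1%:R * (eta (d x) ^+ n * theta (d x)) * gap x.
  by rewrite !mulr_ge0 ?exprn_ge0 ?theta_ge0 ?gap_ge0.
set G := n.+1%:R * (eta (d x) ^+ n * theta (d x)) * gap x in G0 *.
have -> : n.+1%:R * outflow x * (eta (d x) ^+ n * theta (d x)) * gap x =
  outflow x * G by rewrite /G; ring.
rewrite (outflow_ball xN) mulr_suml [leRHS]big_mkcond [leLHS]big_mkcond /=.
apply: ler_sum => y _; do 2!case: ifP => // _.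
by rewrite mulr_ge0 ?mu_ge0.
Qed.

(** [lap_le] is multiplied by [psi] and summed by parts. On the source side [test >= 1] is dropped;
    the energy from [vertex_flux] is moved to the left. *)
Lemma main_estimate :
  \sum_(x <- B | u x < M)
     (mV x * source x * eta (d x) ^+ n.+1 +
      t / p0 * mV x * (descent x `^ m / u x) * eta (d x) ^+ n.+1) <=
  \sum_(x <- B | u x < M)
     n.+1%:R * outflow x * (eta (d x) ^+ n * theta (d x)) * gap x.
Proof.
have muC x y : mu x y = mu y x by case: wmu.
have := sum_antisym B u psi muC (@phi_mN R m).
have : \sum_(x <- B | u x < M) mV x * source x * eta (d x) ^+ n.+1 <=
    \sum_(x <- B) psi x * \sum_(y <- B) mu x y * phi_m m (u x - u y).
  rewrite big_mkcond; apply: ler_sum => x _.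
  (* Vertices at distance [N] may have neighbours outside [B]; the cutoff kills them before
     [nb_ball] is applied. *)
  have [Nx|xN] := leqP N (d x).
    by rewrite /psi eta_supp// exprS !mul0r !mulr0 mul0r; case: ifP.
  rewrite -(nb_ball xpredT (fun y => phi_m m (u x - u y)) xN).
  have lap := lap_le lf wmu hp0 usol x.
  have S0 : 0 <= mV x * source x.
    by rewrite mulr_ge0 ?muV_ge0// mulr_ge0 ?powR_ge0.
  apply: (@le_trans _ _ (psi x * (mV x * source x))); last first.
    by rewrite ler_wpM2l ?psi_ge0.
  case: ifP => xM; last by rewrite mulr_ge0 ?psi_ge0.
  rewrite mulrC ler_wpM2r// /psi ler_peMl ?exprn_ge0// test_ge1//.
move=> + eq; rewrite eq => h; rewrite big_split /= -lerBrDr.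
apply: (le_trans h); rewrite -sumrB [leRHS]big_mkcond; apply: ler_sum => x _.
apply: le_trans (vertex_flux x) _.
by case: ifP => // _; rewrite addrC.
Qed.

End Test.
End MainEstimate.

(** * Young's inequality and the logarithmic cutoff *)

Section Young.
Variable R : realType.

(** Each of [A], [B], [C] is at most their sum [S], so the product is at most [S] to the power
    [a + b + c = 1]. *)
Lemma powR_prod3_le (a b c A B C : R) : 0 < a -> 0 <= b -> 0 < c -> a + b + c = 1 ->
  0 <= A -> 0 <= B -> 0 <= C -> A `^ a * B `^ b * C `^ c <= A + B + C.
Proof.
move=> a0 b0 c0 abc A0 B0 C0; pose S := A + B + C.
have S0 : 0 <= S by rewrite !addr_ge0.
rewrite -/S -[leRHS]powRr1// -abc !powRD; last 2 first.
- by rewrite gt_eqF// ltr_wpDr.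
- by rewrite abc oner_eq0.
rewrite !ler_pM ?mulr_ge0 ?powR_ge0// ge0_ler_powR ?nnegrE ?(ltW a0) ?(ltW c0)//.
- by rewrite /S; lra.
- by rewrite /S; lra.
- by rewrite /S; lra.
Qed.

Variables (m p q a c : R) (n : nat).
Let b := p * a.
Hypotheses (a_gt0 : 0 < a) (p_ge0 : 0 <= p) (c_gt0 : 0 < c) (abc : a + b + c = 1).
Hypothesis (qamb : q * a + m * b = m - 1).
Hypotheses (n_gt0 : (0 < n)%N) (nc : 1 <= n.+1%:R * c).

(** The weights [lam] and [nu] stay free: [uniform_bound] takes both small to absorb, while
    [descent_eq0] fixes [nu] and the constant and lets [lam] adapt. *)
Lemma young_pointwise (c0 u D X eta theta t lam nu : R) :
  0 < c0 -> 0 < u -> 0 < D -> 0 <= eta -> eta <= 1 -> 0 <= theta -> 0 < t ->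
  0 < lam -> 0 < nu -> c0 * (u `^ p * D `^ q) <= X ->
  D `^ (m - 1) * (eta ^+ n * theta) <=
  lam * (X * eta ^+ n.+1) + nu * (t * (D `^ m / u) * eta ^+ n.+1) +
  ((lam * c0) `^ (- a) * nu `^ (- b)) `^ c^-1 * (t `^ (- b) * theta) `^ c^-1.
Proof.
move=> c00 u0 D0 e0 e1 th0 t0 l0 nu0 X_ge.
have b0 : 0 <= b by rewrite mulr_ge0// ltW.
set E := eta ^+ n.+1; have E0 : 0 <= E by rewrite exprn_ge0.
set Y1 := u `^ p * D `^ q; set Y2 := D `^ m / u.
have Y10 : 0 < Y1 by rewrite mulr_gt0 ?powR_gt0.
have Y20 : 0 < Y2 by rewrite divr_gt0 ?powR_gt0.
(* The powers of [u] cancel because [b = p * a]; those of [D] add up by [qamb]. *)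
have DE : D `^ (m - 1) = Y1 `^ a * Y2 `^ b.
  rewrite /Y1 /Y2 !powRM ?powR_ge0 ?invr_ge0 ?(ltW u0)// -!powRrM.
  rewrite -powR_inv1 ?(ltW u0)// -powRrM mulN1r powRN -/b [X in _ * X]mulrC.
  rewrite mulrACA divff; last first.
    by rewrite gt_eqF// powR_gt0.
  by rewrite mul1r -powRD ?qamb// (gt_eqF D0) implybT.
(* By [nc], [(n + 1) * (a + b) = (n + 1) * (1 - c) <= n], and [eta <= 1]. *)
have etaE : eta ^+ n <= E `^ (a + b).
  have [->|] := eqVneq eta 0; first by rewrite expr0n gtn_eqF// powR_ge0.
  move=> en0; have e_gt0 : 0 < eta by rewrite lt_neqAle eq_sym en0.
  rewrite /E -!powR_mulrn// -powRrM ger_powR ?e_gt0//.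
  move: nc abc; rewrite -natr1 => h1 h2.
  have -> : a + b = 1 - c by rewrite -h2; ring.
  by rewrite mulrBr mulr1; lra.
(* [Z] holds the inverses of the prefactors produced by the first two terms, so that they cancel in
   the product. *)
pose Z := (lam * c0) `^ (- a) * nu `^ (- b) * (t `^ (- b) * theta).
have Z0 : 0 <= Z by rewrite !mulr_ge0 ?powR_ge0.
have lc0 : 0 < lam * c0 by rewrite mulr_gt0.
apply: (@le_trans _ _ (lam * (c0 * Y1 * E) + nu * (t * Y2 * E) + Z `^ c^-1)); last first.
  rewrite -powRM ?mulr_ge0 ?powR_ge0// lerD2r lerD2r ler_pM2l//.
  by rewrite ler_wpM2r.
apply: le_trans (powR_prod3_le a_gt0 b0 c_gt0 abc _ _ _); last 3 first.
- by rewrite mulr_ge0 ?(ltW l0)// mulr_ge0// mulr_ge0 ?(ltW c00) ?(ltW Y10).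
- by rewrite mulr_ge0 ?(ltW nu0)// mulr_ge0// mulr_ge0 ?(ltW t0) ?(ltW Y20).
- exact: powR_ge0.
rewrite -powRrM mulVf ?gt_eqF// powRr1// DE.
have -> : lam * (c0 * Y1 * E) = (lam * c0) * (Y1 * E) by ring.
have -> : nu * (t * Y2 * E) = nu * (t * (Y2 * E)) by ring.
have YE1 : 0 <= Y1 * E by rewrite mulr_ge0// ltW.
have YE2 : 0 <= Y2 * E by rewrite mulr_ge0// ltW.
rewrite powRM ?(ltW lc0)// [(nu * _) `^ b]powRM ?(ltW nu0)//; last by rewrite mulr_ge0// ltW.
rewrite (@powRM _ t) ?(ltW t0)// (@powRM _ Y1) ?(ltW Y10)// (@powRM _ Y2) ?(ltW Y20)//.
rewrite /Z !powRN.
have n1 : (lam * c0) `^ a != 0 by rewrite gt_eqF// powR_gt0.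
have n2 : nu `^ b != 0 by rewrite gt_eqF// powR_gt0.
have n3 : t `^ b != 0 by rewrite gt_eqF// powR_gt0.
have -> : (lam * c0) `^ a * (Y1 `^ a * E `^ a) * (nu `^ b * (t `^ b * (Y2 `^ b * E `^ b))) *
    (((lam * c0) `^ a)^-1 * (nu `^ b)^-1 * ((t `^ b)^-1 * theta)) =
    Y1 `^ a * Y2 `^ b * (E `^ a * E `^ b * theta) by field; rewrite n1 n2 n3.
rewrite -powRD; last by rewrite gt_eqF// ltr_wpDr.
by rewrite ler_wpM2l ?mulr_ge0 ?powR_ge0// ler_wpM2r.
Qed.

End Young.

(** * The logarithmic cutoff on dyadic scales *)

Section Cutoff.
Variables (R : realType) (k : nat).
Hypothesis k_gt0 : (0 < k)%N.

(** Comparable to [1 / (k * r)] and constant on dyadic blocks, so that [cutoff] is a discrete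
    [2 - log_2 r / k], clipped to values between 0 and 1. *)
Definition slope (r : nat) : R :=
  if (2 ^ k <= r < 2 ^ (2 * k))%N then (k%:R * 2 ^+ trunc_log 2 r)^-1 else 0.

Definition cutoff (r : nat) : R := \sum_(r <= i < 2 ^ (2 * k)) slope i.

Lemma slope_ge0 (r : nat) : 0 <= slope r.
Proof. by rewrite /slope; case: ifP => // _; rewrite invr_ge0 mulr_ge0 ?exprn_ge0. Qed.

Lemma slope_le1 (r : nat) : slope r <= 1.
Proof.
rewrite /slope; case: ifP => // _; rewrite invf_le1.
  by rewrite -natrX -natrM ler1n muln_gt0 k_gt0 expn_gt0.
by rewrite mulr_gt0 ?exprn_gt0 ?ltr0n.
Qed.

Lemma cutoff_ge0 (r : nat) : 0 <= cutoff r.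
Proof. by apply: sumr_ge0 => i _; exact: slope_ge0. Qed.

Lemma cutoff_supp (r : nat) : (2 ^ (2 * k) <= r)%N -> cutoff r = 0.
Proof. by move=> h; rewrite /cutoff big_geq. Qed.

Lemma cutoff_slope (r : nat) : cutoff r - cutoff r.+1 = slope r.
Proof.
have [h|h] := ltnP r (2 ^ (2 * k)); first by rewrite /cutoff big_ltn// addrK.
by rewrite !cutoff_supp ?(leqW h)// subrr /slope ltnNge h andbF.
Qed.

Lemma cutoff_noninc (r s : nat) : (r <= s)%N -> cutoff s <= cutoff r.
Proof.
move=> /subnK <-; elim: (s - r)%N => [//|i IH].
by apply: le_trans IH; rewrite addSn -subr_ge0 cutoff_slope slope_ge0.
Qed.

Lemma sum_dyadic (l : nat) :
  \sum_(2 ^ k <= i < 2 ^ (k + l)) (2 ^+ trunc_log 2 i : R)^-1 = l%:R.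
Proof.
elim: l => [|l IH]; first by rewrite addn0 big_geq.
have le1 : (2 ^ k <= 2 ^ (k + l))%N by rewrite leq_exp2l// leq_addr.
have le2 : (2 ^ (k + l) <= 2 ^ (k + l.+1))%N by rewrite leq_exp2l// leq_add2l.
rewrite (big_cat_nat le1 le2) /= IH -[in RHS]natr1; congr (_ + _).
rewrite (eq_big_nat _ _ (F2 := fun _ => (2 ^+ (k + l))^-1)); last first.
  by move=> i /andP[h1 h2]; rewrite (@trunc_log_eq 2 (k + l))// -addnS h1.
rewrite sumr_const_nat addnS expnS mul2n -addnn addnK -[_ *+ _]mulr_natl.
by rewrite natrX mulfV// expf_neq0// pnatr_eq0.
Qed.

Lemma cutoff1 (r : nat) : (r <= 2 ^ k)%N -> cutoff r = 1.
Proof.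
move=> rk; have kk : (2 ^ k <= 2 ^ (2 * k))%N by rewrite leq_exp2l// mul2n -addnn leq_addr.
rewrite /cutoff (big_cat_nat rk kk) /= big_nat_cond big1 ?add0r; last first.
  by move=> i /andP[/andP[_ h] _]; rewrite /slope leqNgt h.
rewrite (eq_big_nat _ _ (F2 := fun i => k%:R^-1 * (2 ^+ trunc_log 2 i : R)^-1)).
  by rewrite -mulr_sumr mul2n -addnn sum_dyadic mulVf// pnatr_eq0 -lt0n.
by move=> i h; rewrite /slope h invfM.
Qed.

Lemma cutoff_le1 (r : nat) : cutoff r <= 1.
Proof. by rewrite -(cutoff1 (leq0n _)) cutoff_noninc. Qed.

(** The term [j = trunc_log 2 r] suffices. Full balls replace dyadic annuli because [W] is
    controlled on balls. *)
Lemma slope_powR_le (r : nat) (g : R) : 0 < g ->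
  slope r `^ g <= \sum_(k <= j < 2 * k | (r <= 2 ^ j.+1)%N)
     (k%:R * 2 ^+ j) `^ (- g).
Proof.
move=> g0; have S0 : 0 <= \sum_(k <= j < 2 * k | (r <= 2 ^ j.+1)%N)
     (k%:R * 2 ^+ j : R) `^ (- g) by apply: sumr_ge0 => j _; exact: powR_ge0.
rewrite {1}/slope; case: ifP => [/andP[h1 h2]|_]; last by rewrite powR0 ?gt_eqF.
have r0 : (0 < r)%N by apply: leq_trans h1; rewrite expn_gt0.
have /andP[l1 l2] := @trunc_log_bounds 2 r isT r0.
have j1 : (k <= trunc_log 2 r)%N by rewrite trunc_log_max.
have j2 : (trunc_log 2 r < 2 * k)%N.
  by rewrite -(ltn_exp2l _ _ (isT : 1 < 2)%N) (leq_ltn_trans l1).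
rewrite big_mkcond (bigD1_seq (trunc_log 2 r)) ?iota_uniq ?mem_index_iota ?j1//= (ltnW l2).
rewrite -powR_inv1 ?mulr_ge0 ?exprn_ge0// -powRrM mulN1r lerDl.
by apply: sumr_ge0 => j _; case: ifP => // _; exact: powR_ge0.
Qed.

End Cutoff.

(** Otherwise [T] would grow at least linearly from [i0] on and overtake [A]. *)
Lemma small_increment (R : realType) (T : nat -> R) (A e : R) (i0 : nat) : 0 < e ->
  (forall i, 0 <= T i) -> (forall i, (i0 <= i)%N -> T i <= A) ->
  exists2 i, (i0 <= i)%N & T i.+1 - T i <= e.
Proof.
move=> e0 T0 TA; apply: contrapT => /forall2NP H.
have inc j : T (i0 + j)%N >= j%:R * e.
  elim: j => [|j IH]; first by rewrite mul0r.
  have [/negP|/negP] := H (i0 + j)%N; first by rewrite leq_addr.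
  by rewrite -ltNge addnS -natr1 mulrDl mul1r => ?; lra.
have := inc (Num.trunc (A / e)).+1; have := TA (i0 + (Num.trunc (A / e)).+1)%N (leq_addr _ _).
move=> h1 /le_trans/(_ h1); apply/negP; rewrite -ltNge -ltr_pdivrMr//.
exact: truncnS_gt.
Qed.

(** * Volume growth and iteration *)

Section Growth.
Variables (V : choiceType) (adj : rel V) (R : realType) (mu : V -> V -> R).
Variables (o : V) (C gamma beta : R) (n1 : nat).
Hypotheses (conn : connected_graph adj).
Hypotheses (lf : locally_finite adj) (wmu : weight adj mu).
Hypotheses (C_gt0 : 0 < C) (gamma_gt0 : 0 < gamma) (beta_ge0 : 0 <= beta).
Hypothesis growth : forall n : nat, (n1 <= n)%N ->
  W adj mu o n <= C * (n%:R `^ gamma) * (ln (n%:R : R) `^ beta).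

Local Notation d := (dist adj o).
Local Notation outflow := (outflow adj mu o).

Lemma W_ball (n : nat) : W adj mu o n = \sum_(x <- ball adj o n) outflow x.
Proof. by rewrite /W fsbig_finite//; exact: finite_ball. Qed.

Lemma ln2_le1 : ln (2 : R) <= 1.
Proof. by have -> : 2 = 1 + 1 :> R by []; apply: le_ln1Dx; lra. Qed.

Lemma W_pow2 (k j : nat) : (n1 <= 2 ^ k)%N -> (k <= j)%N -> (j < 2 * k)%N ->
  W adj mu o (2 ^ j.+1) <=
  C * 2 `^ (gamma + beta) * k%:R `^ beta * (2 ^+ j) `^ gamma.
Proof.
move=> n1k kj jk; have n1j : (n1 <= 2 ^ j.+1)%N.
  by rewrite (leq_trans n1k)// leq_exp2l// (leq_trans kj).
apply: le_trans (growth n1j) _.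
have -> : C * 2 `^ (gamma + beta) * k%:R `^ beta * (2 ^+ j) `^ gamma =
  C * (2 * 2 ^+ j) `^ gamma * (2 * k%:R) `^ beta.
  rewrite !powRM ?exprn_ge0// powRD; last by rewrite pnatr_eq0 implybT.
  ring.
rewrite natrX exprS ler_wpM2l ?mulr_ge0 ?powR_ge0 ?(ltW C_gt0)//.
rewrite ge0_ler_powR ?nnegrE ?mulr_ge0//.
  by rewrite ln_ge0// -exprS -natrX ler1n expn_gt0.
rewrite -exprS lnXn// -[leLHS]mulr_natr -natrM.
have h : (j.+1%:R : R) <= (2 * k)%:R by rewrite ler_nat.
apply: le_trans h; rewrite ler_piMl ?ln2_le1//.
Qed.

(** With the growth exponent as power of the slope, the factors [2 ^ j] cancel: each of the [k]
    scales contributes a multiple of [k ^ (beta - gamma)]. *)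
Lemma sum_slope_le (k : nat) : (0 < k)%N -> (n1 <= 2 ^ k)%N ->
  \sum_(x <- ball adj o (2 ^ (2 * k))) outflow x * slope R k (d x) `^ gamma <=
  C * 2 `^ (gamma + beta) * k%:R `^ (1 + beta - gamma).
Proof.
move=> k0 n1k; set B := ball _ _ _.
have kR : 0 < k%:R :> R by rewrite ltr0n.
apply: (@le_trans _ _ (\sum_(x <- B) \sum_(k <= j < 2 * k | (d x <= 2 ^ j.+1)%N)
    outflow x * (k%:R * 2 ^+ j) `^ (- gamma))).
  apply: ler_sum => x _; rewrite -mulr_sumr ler_wpM2l ?outflow_ge0//.
  exact: slope_powR_le.
under eq_bigr do rewrite big_mkcond.
rewrite exchange_big /=.
apply: (@le_trans _ _ (\sum_(k <= j < 2 * k)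
    C * 2 `^ (gamma + beta) * k%:R `^ (beta - gamma))).
  rewrite big_nat_cond [leRHS]big_nat_cond; apply: ler_sum => j /andP[/andP[kj jk] _].
  rewrite -big_mkcond -mulr_suml /=.
  have -> : \sum_(x <- B | (d x <= 2 ^ j.+1)%N) outflow x = W adj mu o (2 ^ j.+1).
    rewrite W_ball -big_filter; apply: perm_big; apply: uniq_perm.
    - by rewrite filter_uniq// ball_uniq.
    - exact: ball_uniq.
    move=> x; rewrite mem_filter !mem_ball//; apply/andP/idP => [[]//|h].
    by split=> //; rewrite (leq_trans h)// leq_exp2l.
  apply: le_trans (ler_wpM2r (powR_ge0 _ _) (W_pow2 n1k kj jk)) _.
  have p2 : 0 < 2 ^+ j :> R by rewrite exprn_gt0.
  have n2 : (2 ^+ j : R) `^ gamma != 0 by rewrite gt_eqF ?powR_gt0.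
  rewrite powRM ?(ltW p2)// [k%:R `^ (beta - gamma)]powRD ?(gt_eqF kR) ?implybT//.
  rewrite !powRN le_eqVlt; apply/orP; left; apply/eqP; field.
  by rewrite n2 gt_eqF// powR_gt0.
rewrite sumr_const_nat mul2n -addnn addnK -[leLHS]mulr_natr -mulrA ler_wpM2l//.
  by rewrite mulr_ge0 ?powR_ge0 ?(ltW C_gt0).
rewrite -{2}[k%:R]powRr1 ?ler0n// -powRD ?(gt_eqF kR) ?implybT//.
by rewrite (_ : beta - gamma + 1 = 1 + beta - gamma)//; ring.
Qed.

(** A crude bound, exponential in [k], that the decay of [delta] beats in [sum_delta_le]. *)
Lemma sum_slope1_le (k : nat) : (0 < k)%N -> (n1 <= 2 ^ k)%N ->
  \sum_(x <- ball adj o (2 ^ (2 * k))) outflow x * slope R k (d x) <=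
  C * expR ((2 * gamma + 2 * beta) * k%:R).
Proof.
move=> k0 n1k; have kR : 0 < k%:R :> R by rewrite ltr0n.
apply: (@le_trans _ _ (W adj mu o (2 ^ (2 * k)))).
  rewrite W_ball; apply: ler_sum => x _.
  by rewrite ler_piMr ?slope_le1// outflow_ge0.
have n1j : (n1 <= 2 ^ (2 * k))%N.
  by rewrite (leq_trans n1k)// leq_exp2l// mul2n -addnn leq_addr.
apply: le_trans (growth n1j) _.
rewrite -mulrA ler_pM2l// mulrDl expRD natrX.
have lnk : ln (2 ^+ (2 * k) : R) <= 2 * k%:R.
  by rewrite lnXn// -[leLHS]mulr_natr natrM ler_piMl ?ln2_le1// mulr_ge0.
have ln0 : 0 <= ln (2 ^+ (2 * k) : R).
  by rewrite ln_ge0// -natrX ler1n expn_gt0.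
apply: ler_pM; rewrite ?powR_ge0//.
  rewrite /powR gt_eqF ?exprn_gt0// ler_expR mulrAC mulrC.
  by rewrite ler_wpM2r// ltW.
apply: (@le_trans _ _ ((2 * k%:R) `^ beta)).
  by rewrite ge0_ler_powR ?nnegrE ?mulr_ge0.
rewrite /powR gt_eqF ?mulr_gt0// ler_expR (mulrC 2 beta) -mulrA ler_wpM2l//.
by rewrite ltW// ln_sublinear// mulr_gt0.
Qed.

End Growth.

(** * Absorption and vanishing of the descent *)

Section Iteration.
Variables (V : choiceType) (adj : rel V) (R : realType) (mu : V -> V -> R).
Variables (p0 m p q C : R) (n1 : nat) (u : V -> R) (o : V).
Hypotheses (conn : connected_graph adj).
Hypotheses (lf : locally_finite adj) (wmu : weight adj mu).
Hypotheses (hp0 : cond_p0 adj mu p0) (m_gt1 : 1 < m).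
Hypotheses (p_ge0 : 0 <= p) (q_gt : m - 1 - p < q).
Hypothesis (C_gt0 : 0 < C).

Local Notation gamma := ((m * p + q) / (p + q - m + 1)).
Local Notation beta := ((m - 1) / (p + q - m + 1)).
Local Notation a := ((m - 1) / (m * p + q)).
Local Notation b := (p * a).

Hypothesis growth : forall n : nat, (n1 <= n)%N ->
  W adj mu o n <= C * (n%:R `^ gamma) * (ln (n%:R : R) `^ beta).
Hypothesis (u_gt0 : forall x, 0 < u x).
Hypothesis (usol : forall x, supersol_at adj mu m p q u x).

Local Notation mV := (muV adj mu).
Local Notation d := (dist adj o).
Local Notation descent := (descent adj u).
Local Notation H := (1 + harn p0 m).
Local Notation source := (source adj mu p q u).
Local Notation outflow := (outflow adj mu o).
Local Notation B k := (ball adj o (2 ^ (2 * k))).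

Variables (M c0 : R).
Hypotheses (M_gt0 : 0 < M) (c0_gt0 : 0 < c0).
Hypothesis source_ge : forall x, 0 < descent x ->
  c0 * (u x `^ p * descent x `^ q) <= source x.

Let pq_gt0 : 0 < p + q - m + 1. Proof. by have := q_gt; rewrite -subr_gt0 => h; lra. Qed.

Let mpq_gt0 : 0 < m * p + q.
Proof.
have : 0 <= (m - 1) * p by rewrite mulr_ge0// subr_ge0 ltW.
by have := pq_gt0; have := m_gt1; rewrite mulrBl mul1r; lra.
Qed.

Let m1_gt0 : 0 < m - 1. Proof. by rewrite subr_gt0. Qed.
Let gamma_gt0 : 0 < gamma. Proof. by rewrite divr_gt0. Qed.
Let beta_gt0 : 0 < beta. Proof. by rewrite divr_gt0. Qed.
Let a_gt0 : 0 < a. Proof. by rewrite divr_gt0. Qed.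

Let abc : a + b + gamma^-1 = 1.
Proof. by field; rewrite !gt_eqF. Qed.

Let qamb : q * a + m * b = m - 1.
Proof. by field; rewrite !gt_eqF. Qed.

(** The cutoff is raised to the power [expo.+1], which must be at least [gamma] in
    [young_pointwise]. *)
Definition expo : nat := (Num.trunc gamma).+1.

Let expo_gamma : 1 <= expo.+1%:R * gamma^-1.
Proof.
rewrite ler_pdivlMr// mul1r; apply/ltW.
by apply: lt_le_trans (truncnS_gt _) _; rewrite ler_nat.
Qed.

(* Large enough that [delta ^ (m-1)] beats the growth of [W] at radius [2^(2k)] by
a factor [exp(- k)], and at least [1] so that [tk k <= 1]. *)
Definition rate : R := (2 * gamma + 2 * beta + 1) / (m - 1) + 1.

Let rate_ge1 : 1 <= rate.
Proof.
rewrite /rate lerDr divr_ge0 ?(ltW m1_gt0)//.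
have := gamma_gt0; have := beta_gt0; lra.
Qed.

Definition tk (k : nat) : R := (rate * k%:R)^-1.

Definition young_const (lam nu : R) : R :=
  ((lam * c0) `^ (- a) * nu `^ (- b)) `^ gamma.

Local Notation E k x := (cutoff R k (d x) ^+ expo.+1).

Section Step.
Variable (k : nat).
Hypothesis (k_gt0 : (0 < k)%N).
Local Notation t := (tk k).

Let kR : 0 < k%:R :> R. Proof. by rewrite ltr0n. Qed.

Lemma rk_gt0 : 0 < rate * k%:R.
Proof. by rewrite mulr_gt0// (lt_le_trans ltr01). Qed.

Lemma tk_gt0 : 0 < t. Proof. by rewrite invr_gt0 rk_gt0. Qed.

Lemma tk_le1 : t <= 1.
Proof.
rewrite invf_le1 ?rk_gt0//; apply: (le_trans rate_ge1).
by rewrite ler_peMr ?ler1n// (le_trans ler01).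
Qed.

Definition annulus (x : V) : bool := (2 ^ k <= d x < 2 ^ (2 * k))%N.

(** [young_pointwise] times [outflow x]; the bound [outflow x <= mV x] turns the first two terms
    into those on the left of [main_estimate]. *)
Lemma vertex_young (lam nu : R) (x : V) : 0 < lam -> 0 < nu ->
  outflow x * (cutoff R k (d x) ^+ expo * slope R k (d x)) * gap adj p0 m u M t x <=
  2 * (lam * (if annulus x then mV x * source x * E k x else 0) +
       nu * (t * (mV x * (descent x `^ m / u x) * E k x)) +
       young_const lam nu * (t `^ (- b)) `^ gamma *
         (outflow x * slope R k (d x) `^ gamma)) +
  delta p0 m M t `^ (m - 1) / (m - 1) * (outflow x * slope R k (d x)).
Proof.
move=> lam0 nu0; have e0 := outflow_ge0 o conn lf wmu x.
have em := outflow_le o conn lf wmu x.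
have mV0 : 0 <= mV x by apply: muV_ge0.
have X0 : 0 <= source x by rewrite mulr_ge0 ?powR_ge0.
have Y0 : 0 <= descent x `^ m / u x by rewrite mulr_ge0 ?powR_ge0// invr_ge0 ltW.
have c00 : 0 <= cutoff R k (d x) := cutoff_ge0 _ _ _.
have c01 : cutoff R k (d x) <= 1 by apply: cutoff_le1.
have E0 : 0 <= E k x by rewrite exprn_ge0.
have s0 : 0 <= slope R k (d x) := slope_ge0 _ _ _.
have t0 := ltW tk_gt0.
rewrite /gap mulrDr lerD//; last first.
  rewrite [leLHS]mulrC ler_wpM2l//.
    by rewrite mulr_ge0 ?powR_ge0// invr_ge0 ltW.
  by rewrite ler_wpM2l// ler_piMl// exprn_ile1.
rewrite [leLHS]mulrCA ler_pM2l//.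
have K0 : 0 <= young_const lam nu * (t `^ (- b)) `^ gamma *
         (outflow x * slope R k (d x) `^ gamma).
  by rewrite !mulr_ge0 ?powR_ge0.
have N0 : 0 <= nu * (t * (mV x * (descent x `^ m / u x) * E k x)).
  by rewrite (mulr_ge0 (ltW nu0))// mulr_ge0// mulr_ge0// mulr_ge0.
(* The slope vanishes off the annulus, which confines the [lam] term to it. *)
case: ifPn => ann; last first.
  have s00 : slope R k (d x) = 0 by rewrite /slope -/(annulus x) (negPf ann).
  by rewrite [in leLHS]s00 !mulr0 mul0r add0r addr_ge0.
have L0 : 0 <= lam * (mV x * source x * E k x).
  by rewrite (mulr_ge0 (ltW lam0))// mulr_ge0// mulr_ge0.
have := descent_ge0 adj u x; rewrite le_eqVlt => /orP[/eqP D0|D0].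
  by rewrite -[in leLHS]D0 powR0 ?gt_eqF// mulr0 !addr_ge0.
have g0 : 0 < gamma^-1 by rewrite invr_gt0.
have := @young_pointwise R m p q a gamma^-1 expo a_gt0 p_ge0 g0 abc qamb isT expo_gamma
  _ _ _ _ _ _ _ _ _ c0_gt0 (u_gt0 x) D0 c00 c01 s0 tk_gt0 lam0 nu0 (source_ge D0).
rewrite [gamma^-1^-1]invrK => /(ler_wpM2l e0).
have -> : outflow x * (cutoff R k (d x) ^+ expo * slope R k (d x)) * descent x `^ (m - 1) =
  outflow x * (descent x `^ (m - 1) * (cutoff R k (d x) ^+ expo * slope R k (d x))) by ring.
move=> /le_trans; apply.
rewrite [(t `^ (- b) * _) `^ gamma]powRM ?powR_ge0// !mulrDr; apply: lerD; first apply: lerD.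
- by rewrite mulrCA ler_pM2l// mulrA ler_wpM2r// ler_wpM2r.
- rewrite mulrCA ler_pM2l//.
  have -> : outflow x * (t * (descent x `^ m / u x) * E k x) =
    outflow x * (t * ((descent x `^ m / u x) * E k x)) by ring.
  have -> : t * (mV x * (descent x `^ m / u x) * E k x) =
    mV x * (t * ((descent x `^ m / u x) * E k x)) by ring.
  by rewrite ler_wpM2r// (mulr_ge0 t0)// mulr_ge0.
- by rewrite /young_const le_eqVlt; apply/orP; left; apply/eqP; ring.
Qed.

Definition volume_const : R := C * 2 `^ (gamma + beta) * rate `^ (b * gamma).

(** Criticality of the growth: the factor [k ^ (b * gamma)] coming from [t] exactly compensates
    [k ^ (1 + beta - gamma)], so the bound is uniform in [k]. *)
Lemma sum_young_le : (n1 <= 2 ^ k)%N ->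
  (t `^ (- b)) `^ gamma * \sum_(x <- B k) outflow x * slope R k (d x) `^ gamma
  <= volume_const.
Proof.
move=> n1k.
have := sum_slope_le conn lf wmu C_gt0 gamma_gt0 (ltW beta_gt0) growth k_gt0 n1k.
move=> /(ler_wpM2l (powR_ge0 (t `^ (- b)) gamma)) /le_trans; apply.
have r0 : 0 <= rate by apply: le_trans rate_ge1.
rewrite -powRrM /tk -powR_inv1 ?(ltW rk_gt0)// -powRrM mulN1r mulNr opprK.
rewrite powRM ?(ltW kR)// /volume_const.
have -> : rate `^ (b * gamma) * k%:R `^ (b * gamma) *
    (C * 2 `^ (gamma + beta) * k%:R `^ (1 + beta - gamma)) =
  C * 2 `^ (gamma + beta) * rate `^ (b * gamma) *
    (k%:R `^ (b * gamma) * k%:R `^ (1 + beta - gamma)) by ring.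
rewrite -powRD ?(gt_eqF kR) ?implybT//.
have -> : b * gamma + (1 + beta - gamma) = 0 by field; rewrite !gt_eqF.
by rewrite powRr0 mulr1.
Qed.

Lemma sum_delta_le : (n1 <= 2 ^ k)%N ->
  delta p0 m M t `^ (m - 1) / (m - 1) * \sum_(x <- B k) outflow x * slope R k (d x)
  <= (M * H) `^ (m - 1) / (m - 1) * C / k%:R.
Proof.
move=> n1k.
have := sum_slope1_le conn lf wmu C_gt0 gamma_gt0 (ltW beta_gt0) growth k_gt0 n1k.
have P0 : 0 <= delta p0 m M t `^ (m - 1) / (m - 1).
  by rewrite mulr_ge0 ?powR_ge0// invr_ge0 ltW.
move=> /(ler_wpM2l P0) /le_trans; apply.
have MH : 0 <= M * H by rewrite mulr_ge0 ?(ltW M_gt0) ?(ltW (H_gt0 p0 m)).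
rewrite /delta powRM ?expR_ge0// -expRM.
have -> : (M * H) `^ (m - 1) * expR (- t^-1 * (m - 1)) / (m - 1) *
   (C * expR ((2 * gamma + 2 * beta) * k%:R)) =
   (M * H) `^ (m - 1) / (m - 1) * C *
   (expR (- t^-1 * (m - 1)) * expR ((2 * gamma + 2 * beta) * k%:R)) by ring.
rewrite ler_wpM2l//.
  by rewrite mulr_ge0 ?(ltW C_gt0)// mulr_ge0 ?powR_ge0// invr_ge0 ltW.
rewrite -expRD /tk invrK.
(* Here [rate * (m - 1) = 2 * gamma + 2 * beta + m]; then [exp (m * k) >= k] finishes. *)
have -> : - (rate * k%:R) * (m - 1) + (2 * gamma + 2 * beta) * k%:R = - (m * k%:R).
  rewrite /rate; field; rewrite !gt_eqF//.
rewrite expRN lef_pV2 ?posrE ?expR_gt0//.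
apply: le_trans (expR_ge1Dx _); rewrite (@le_trans _ _ (m * k%:R))//.
  by rewrite ler_peMl ?ltW.
by rewrite lerDr.
Qed.

Lemma iteration_step (lam nu : R) : 0 < lam -> 0 < nu -> (n1 <= 2 ^ k)%N ->
  \sum_(x <- B k | u x < M) mV x * source x * E k x +
  t / p0 * (\sum_(x <- B k | u x < M) mV x * (descent x `^ m / u x) * E k x) <=
  expo.+1%:R *
  (2 * (lam * (\sum_(x <- B k | (u x < M) && annulus x) mV x * source x * E k x) +
        nu * (t * (\sum_(x <- B k | u x < M) mV x * (descent x `^ m / u x) * E k x)) +
        young_const lam nu * volume_const) +
   (M * H) `^ (m - 1) / (m - 1) * C / k%:R).
Proof.
move=> lam0 nu0 n1k.
have := @main_estimate _ _ _ mu p0 m p q u o conn lf wmu hp0 m_gt1 u_gt0 usol M t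
  (2 ^ (2 * k)) expo (cutoff R k) M_gt0 tk_gt0 tk_le1 (cutoff_ge0 R k)
  (@cutoff_noninc R k) (@cutoff_supp R k).
move=> h; pose X x := mV x * source x * E k x.
pose Y x := mV x * (descent x `^ m / u x) * E k x.
have -> : \sum_(x <- B k | u x < M) X x + t / p0 * (\sum_(x <- B k | u x < M) Y x) =
  \sum_(x <- B k | u x < M) (mV x * source x * E k x +
    t / p0 * mV x * (descent x `^ m / u x) * E k x).
  by rewrite mulr_sumr -big_split; apply: eq_bigr => x _ /=; rewrite /X /Y; ring.
apply: (le_trans h) => {h}.
have sub (F : V -> R) : (forall x, 0 <= F x) ->
    \sum_(x <- B k | u x < M) F x <= \sum_(x <- B k) F x.
  by move=> F0; rewrite big_mkcond; apply: ler_sum => x _; case: ifP.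
have e0 x : 0 <= outflow x by apply: outflow_ge0.
pose c1 := young_const lam nu * (t `^ (- b)) `^ gamma.
pose c2 := delta p0 m M t `^ (m - 1) / (m - 1).
have c10 : 0 <= c1 by rewrite mulr_ge0 ?powR_ge0.
have c20 : 0 <= c2 by rewrite mulr_ge0 ?powR_ge0// invr_ge0 ltW.
apply: (@le_trans _ _ (\sum_(x <- B k | u x < M) expo.+1%:R *
  (2 * (lam * (if annulus x then X x else 0) + nu * (t * Y x) +
       c1 * (outflow x * slope R k (d x) `^ gamma)) +
  c2 * (outflow x * slope R k (d x))))).
  apply: ler_sum => x _.
  apply: le_trans (ler_wpM2l (ler0n _ _) (vertex_young x lam0 nu0)).
  by rewrite cutoff_slope !mulrA.
rewrite -mulr_sumr ler_pM2l ?ltr0n// big_split /= -mulr_sumr -mulr_sumr.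
apply: lerD; last first.
  apply: le_trans (sum_delta_le n1k); rewrite ler_wpM2l// sub// => x.
  by rewrite mulr_ge0 ?slope_ge0.
rewrite ler_pM2l// big_split big_split /= -!mulr_sumr -/c1.
apply: lerD; first by rewrite big_mkcondr.
rewrite /c1 -mulrA; rewrite ler_wpM2l ?powR_ge0//.
apply: le_trans (sum_young_le n1k); rewrite ler_wpM2l ?powR_ge0//.
by rewrite sub// => x; rewrite mulr_ge0 ?powR_ge0.
Qed.

End Step.
(** As [a > 0], the defining formula can be solved for [lam]. *)
Lemma young_const_onto (nu rho : R) : 0 < nu -> 0 < rho ->
  exists2 lam, 0 < lam & young_const lam nu = rho.
Proof.
move=> nu0 rho0; pose z := rho `^ gamma^-1 * nu `^ b.
have z0 : 0 < z by rewrite mulr_gt0 ?powR_gt0.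
exists (z `^ (- a^-1) / c0); first by rewrite divr_gt0 ?powR_gt0.
have a0 := lt0r_neq0 a_gt0; have g0 := lt0r_neq0 gamma_gt0.
rewrite /young_const divfK ?gt_eqF// -powRrM mulrNN mulVf// powRr1 ?(ltW z0)//.
rewrite /z powRN mulfK; last by rewrite gt_eqF// powR_gt0.
by rewrite -powRrM mulVf// powRr1 ?(ltW rho0).
Qed.

Let sX k := \sum_(x <- B k | u x < M) mV x * source x * E k x.
Let sY k := \sum_(x <- B k | u x < M) mV x * (descent x `^ m / u x) * E k x.
Let sA k :=
  \sum_(x <- B k | (u x < M) && annulus k x) mV x * source x * E k x.

Let mVs_ge0 x : 0 <= mV x * source x.
Proof. by rewrite mulr_ge0 ?muV_ge0// mulr_ge0 ?powR_ge0. Qed.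

Let E_ge0 k x : 0 <= E k x.
Proof. by rewrite exprn_ge0 ?cutoff_ge0. Qed.

(** The sums on the right of [iteration_step] are finite and can be absorbed, [sA] being at most
    [sX]. *)
Lemma uniform_bound : exists2 A : R, 0 <= A & forall k, (0 < k)%N ->
  (n1 <= 2 ^ k)%N -> sX k <= A /\ tk k * sY k <= A.
Proof.
have pp := p0_gt0 hp0; pose N : R := expo.+1%:R; have N0 : 0 < N by rewrite ltr0n.
(* These values make the right-hand coefficients exactly half of those on the left. *)
pose lam := (4 * N)^-1; pose nu := (4 * N * p0)^-1.
have lam0 : 0 < lam by rewrite invr_gt0 mulr_gt0.
have nu0 : 0 < nu by rewrite invr_gt0 !mulr_gt0.
pose C1 := (M * H) `^ (m - 1) / (m - 1) * C.
have C10 : 0 <= C1.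
  by rewrite mulr_ge0 ?(ltW C_gt0)// mulr_ge0 ?powR_ge0// invr_ge0 ltW.
pose Q := young_const lam nu * volume_const.
have Q0 : 0 <= Q.
  by rewrite mulr_ge0 ?powR_ge0// mulr_ge0 ?powR_ge0// mulr_ge0 ?powR_ge0// ltW.
pose A := 2 * N * (2 * Q + C1).
have A0 : 0 <= A.
  apply: mulr_ge0; first by rewrite mulr_ge0// ltW.
  by rewrite addr_ge0// mulr_ge0.
exists (A * (1 + p0)) => [|k k0 n1k].
  by rewrite mulr_ge0// addr_ge0// ltW.
have := iteration_step k0 lam0 nu0 n1k; rewrite -/(sX k) -/(sY k) -/(sA k) -/N -/C1 -/Q.
have X0 : 0 <= sX k by apply: sumr_ge0 => x _; rewrite mulr_ge0.
have Y0 : 0 <= tk k * sY k.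
  rewrite mulr_ge0 ?(ltW (tk_gt0 k0))// sumr_ge0// => x _.
  rewrite mulr_ge0// mulr_ge0 ?muV_ge0// mulr_ge0 ?powR_ge0// invr_ge0 ltW//.
have AX : sA k <= sX k.
  rewrite /sA big_mkcondr; apply: ler_sum => x _.
  by case: ifP => // _; rewrite mulr_ge0.
have Ck : C1 / k%:R <= C1.
  by rewrite ler_pdivrMr ?ltr0n// ler_peMr// ler1n.
have -> : tk k / p0 * sY k = tk k * sY k / p0 by rewrite mulrAC.
set y := tk k * sY k in Y0 *.
have -> : N * (2 * (lam * sA k + nu * y + Q) + C1 / k%:R) =
  2^-1 * sA k + 2^-1 * (y / p0) + N * (2 * Q + C1 / k%:R).
  by rewrite /lam /nu; field; rewrite !gt_eqF ?ltr0n.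
have h2 : N * (2 * Q + C1 / k%:R) <= A / 2.
  have -> : A / 2 = N * (2 * Q + C1) by rewrite /A; field.
  by rewrite ler_wpM2l ?(ltW N0)// lerD2l.
have Yp : 0 <= y / p0 by rewrite divr_ge0// ltW.
have Ap : 0 <= A * p0 by rewrite mulr_ge0// ltW.
move=> h; split; rewrite mulrDr mulr1; first by lra.
have : y / p0 <= A by lra.
by rewrite ler_pdivrMr// => ?; lra.
Qed.

(** A positive descent would give [x0] a fixed mass [kap] in every large [sX], while
    [iteration_step] on an annulus of small mass bounds [sX] by less than [kap]. *)
Lemma descent_eq0 (x0 : V) : u x0 < M -> descent x0 = 0.
Proof.
move=> x0M; apply/eqP; apply: contraT => D_neq0.
have D0 : 0 < descent x0 by rewrite lt_neqAle eq_sym D_neq0 descent_ge0.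
have [A A0 bound] := uniform_bound.
have pp := p0_gt0 hp0; pose N : R := expo.+1%:R; have N0 : 0 < N by rewrite ltr0n.
pose kap := mV x0 * source x0.
have kap0 : 0 < kap.
  rewrite mulr_gt0//.
    by have [y xy _] := descent_attained lf D0; exact: (muV_gt0 lf wmu hp0 xy).
  apply: lt_le_trans (source_ge D0).
  by rewrite mulr_gt0// mulr_gt0 ?powR_gt0.
pose C1 := (M * H) `^ (m - 1) / (m - 1) * C.
have C10 : 0 <= C1.
  by rewrite mulr_ge0 ?(ltW C_gt0)// mulr_ge0 ?powR_ge0// invr_ge0 ltW.
have V0 : 0 <= volume_const.
  by rewrite mulr_ge0 ?powR_ge0// mulr_ge0 ?powR_ge0// ltW.
(* Constants are chosen in the order [nu], [rho], [lam], [e]: the [nu] and [rho] terms cost at most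
   [kap / 4] each, the annulus and the final error [kap / 8] each. *)
pose nu := kap / (8 * N * (A + 1)).
have nu0 : 0 < nu by rewrite divr_gt0// mulr_gt0 ?mulr_gt0// ltr_wpDl.
have nuA : N * (2 * (nu * A)) <= kap / 4.
  have -> : N * (2 * (nu * A)) = kap / 4 * (A / (A + 1)).
    by rewrite /nu; field; rewrite !gt_eqF// ltr_wpDl.
  by rewrite ler_piMr ?divr_ge0 ?(ltW kap0)// ler_pdivrMr ?ltr_wpDl// mul1r lerDl.
pose rho := kap / (8 * N * (volume_const + 1)).
have rho0 : 0 < rho by rewrite divr_gt0// mulr_gt0 ?mulr_gt0// ltr_wpDl.
have rhoV : N * (2 * (rho * volume_const)) <= kap / 4.
  have -> : N * (2 * (rho * volume_const)) = kap / 4 * (volume_const / (volume_const + 1)).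
    by rewrite /rho; field; rewrite !gt_eqF// ltr_wpDl.
  by rewrite ler_piMr ?divr_ge0 ?(ltW kap0)// ler_pdivrMr ?ltr_wpDl// mul1r lerDl.
have [lam lam0 lamE] := young_const_onto nu0 rho0.
pose e := kap / (16 * N * lam).
have e0 : 0 < e by rewrite divr_gt0// !mulr_gt0.
(* With [k = 2 ^ i] the annulus runs from the radius [2 ^ (2 ^ i)] to the next one of this form, so
   an increment of [T] bounds [sA]. *)
pose T i := \sum_(x <- ball adj o (2 ^ (2 ^ i)) | (u x < M) && (d x < 2 ^ (2 ^ i))%N)
   mV x * source x.
have T0 i : 0 <= T i by apply: sumr_ge0.
have TE i j : (i <= j)%N -> T i =
    \sum_(x <- ball adj o (2 ^ (2 ^ j)) | (u x < M) && (d x < 2 ^ (2 ^ i))%N)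
      mV x * source x.
  move=> ij; rewrite /T -[LHS]big_filter -[RHS]big_filter.
  apply: perm_big; apply: uniq_perm; rewrite ?filter_uniq ?ball_uniq//.
  move=> x; rewrite !mem_filter !mem_ball//; case: (u x < M) => //=.
  case: ltnP => //= h; rewrite (ltnW h); apply/esym.
  by rewrite (leq_trans (ltnW h))// leq_exp2l// leq_exp2l.
have two i : (2 * 2 ^ i = 2 ^ i.+1)%N by rewrite expnS.
have Epre k x : (d x <= 2 ^ k)%N -> (0 < k)%N -> E k x = 1.
  by move=> h k0; rewrite cutoff1// expr1n.
have TX i : T i <= sX (2 ^ i).
  rewrite (TE i i.+1)// /sX two [leLHS]big_mkcondr; apply: ler_sum => x _.
  case: ifP => h; last by rewrite mulr_ge0.
  by rewrite Epre ?mulr1 ?expn_gt0// ltnW.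
have AT i : sA (2 ^ i) <= T i.+1 - T i.
  rewrite (TE i i.+1)// /T /sA two lerBrDr.
  rewrite [leRHS]big_mkcondr [X in X + _]big_mkcondr [X in _ + X]big_mkcondr -big_split.
  apply: ler_sum => x _ /=; rewrite /annulus two.
  have [h|h] := ltnP (d x) (2 ^ (2 ^ i)).
    rewrite /= add0r (leq_trans h)// leq_exp2l// leq_exp2l//.
  rewrite addr0 /=; case: ifP => // _.
  by rewrite ler_piMr// exprn_ile1 ?cutoff_ge0// cutoff_le1 ?expn_gt0.
have large i : (n1 <= i)%N -> (n1 <= 2 ^ (2 ^ i))%N.
  move=> h; apply: (leq_trans h); apply: (@leq_trans (2 ^ i)); first exact/ltnW/ltn_expl.
  exact/ltnW/ltn_expl.
have bigK : exists i1 : nat, forall i, (i1 <= i)%N -> N * (C1 / (2 ^ i)%:R) <= kap / 8.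
  exists (Num.trunc (N * C1 * 8 / kap)).+1 => i hi.
  have i0 : (0 < i)%N by apply: leq_trans hi.
  have p20 : 0 < (2 ^ i)%:R :> R by rewrite ltr0n expn_gt0.
  have : (Num.trunc (N * C1 * 8 / kap)).+1%:R <= (2 ^ i)%:R :> R.
    by rewrite ler_nat (leq_trans hi)// ltnW// ltn_expl.
  move=> /(ler_wpM2r (ltW kap0)); have := truncnS_gt (N * C1 * 8 / kap).
  by rewrite ltr_pdivrMr// mulrA ler_pdivrMr// => *; lra.
have [i1 smallC] := bigK.
(* Beyond [i0] the growth bound applies, [x0] lies where the cutoff is 1, and the final error is
   small. *)
pose i0 := maxn n1 (maxn (d x0) i1).
have [|i] := @small_increment R T A e i0 e0 T0.
  move=> i; rewrite geq_max => /andP[hi _].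
  by apply: le_trans (TX i) _; apply: (bound _ _ (large _ hi)).1; rewrite expn_gt0.
rewrite !geq_max => /andP[h1 /andP[h2 h3]] Ti.
have k0 : (0 < 2 ^ i)%N by rewrite expn_gt0.
have := iteration_step k0 lam0 nu0 (large _ h1).
rewrite -/(sX _) -/(sY _) -/(sA _) -/N -/C1 lamE => st.
have [_ tY] := bound _ k0 (large _ h1).
have kX : kap <= sX (2 ^ i).
  have dx : (d x0 <= 2 ^ (2 ^ i))%N.
    apply: (leq_trans h2); apply: (@leq_trans (2 ^ i)); exact/ltnW/ltn_expl.
  rewrite /sX big_mkcond (bigD1_seq x0) ?ball_uniq ?mem_ball//=; last first.
    by rewrite (leq_trans dx)// leq_exp2l// two leq_exp2l.
  rewrite x0M Epre// mulr1 lerDl sumr_ge0// => x _.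
  by case: ifP => // _; rewrite mulr_ge0.
have Y0 : 0 <= tk (2 ^ i) / p0 * sY (2 ^ i).
  rewrite mulr_ge0 ?divr_ge0 ?(ltW (tk_gt0 k0)) ?(ltW pp)// sumr_ge0// => x _.
  rewrite mulr_ge0// mulr_ge0 ?muV_ge0// mulr_ge0 ?powR_ge0// invr_ge0 ltW//.
have s1 : N * (2 * (lam * sA (2 ^ i))) <= kap / 8.
  have -> : kap / 8 = N * (2 * (lam * e)) by rewrite /e; field; rewrite !gt_eqF.
  rewrite ler_pM2l// ler_pM2l// ler_pM2l//; exact: le_trans (AT i) Ti.
have s2 : N * (2 * (nu * (tk (2 ^ i) * sY (2 ^ i)))) <= kap / 4.
  apply: le_trans nuA; rewrite ler_pM2l// ler_pM2l// ler_pM2l//.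
have s3 := smallC _ h3.
have : kap <= kap / 8 + kap / 4 + kap / 4 + kap / 8.
  apply: (le_trans kX).
  have : sX (2 ^ i) <= N * (2 * (lam * sA (2 ^ i) + nu * (tk (2 ^ i) * sY (2 ^ i)) +
            rho * volume_const) + C1 / (2 ^ i)%:R) by lra.
  move=> /le_trans; apply.
  rewrite mulrDr lerD// 2!mulrDr 2!mulrDr; lra.
by lra.
Qed.

End Iteration.

Theorem theorem1p1 (V : choiceType) (adj : rel V) (R : realType)
  (mu : V -> V -> R) (p0 m p q C : R) (n1 : nat) (o : V) :
  simple_graph adj -> infinite_graph V -> connected_graph adj ->
  locally_finite adj -> weight adj mu -> cond_p0 adj mu p0 ->
  1 < m -> 0 <= p -> m - 1 - p < q -> q < m ->
  0 < C ->
  (forall n : nat, (n1 <= n)%N ->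
     W adj mu o n <=
       C * (n%:R `^ ((m * p + q) / (p + q - m + 1)))
         * (ln (n%:R : R) `^ ((m - 1) / (p + q - m + 1)))) ->
  ~ exists u : V -> R, nontrivial_positive_solution adj mu m p q u.
Proof.
move=> _ _ conn lf wmu hp0 m1 p_ge0 q_gt _ C0 growth.
move=> [u [u0 [[x [y uxy]] usol]]].
have [c0 c00 source_ge] := source_ge lf wmu hp0 m1 usol.
(* The level [u z + 1] is chosen afresh for each [z]. *)
have D0 z : descent adj u z = 0.
  by apply: (@descent_eq0 _ _ _ mu p0 m p q C n1 u o _ _ _ _ _ _ _ _ _ _ _ (u z + 1) c0);
    rewrite ?addr_gt0 ?ltrDl.
have [n [s [_ ps ly]]] := conn x y.
suff : u (last x s) = u x by rewrite ly => e; rewrite e eqxx in uxy.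
elim: s x {uxy ly} ps => [//|z s IHs] x /= /andP[xz ps].
by rewrite IHs//; exact: (descent0_const lf wmu hp0 m1 usol xz (D0 x)).
Qed.
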